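(* Let $0<a_1<\cdots<a_n$, let $p_{ij}\ge 0$ ($i=1,\dots,n$, $j=1,2,\dots$) be such that $\sum_{i=1}^{n}\sum_{j=1}^{\infty}p_{ij}=p\leq 1$, and let $$F(x)=(1-p)+\sum_{i=1}^{n}\sum_{j=1}^{\infty}p_{ij}F_{a_i,j}(x),\qquad x\ge 0,$$ where $F_{a,j}$ is the Erlang distribution function with shape $j$ and scale parameter $a$. Then for every $t>0$, $$\bigl\|M_{t}^{[2]}F-F\bigr\|\leq\Bigl(\frac{17}{12}+\frac{27}{16e}\Bigr)\frac{\sum_{i=1}^{n}\bigl(\sum_{j=1}^{\infty}p_{ij}\bigr)a_{i}^2}{t^2}.$$
   Context: For $a>0$ and $j\in\{1,2,\dots\}$, $F_{a,j}$ is the distribution function with density $f_{a,j}(x)=\dfrac{a^{j}x^{j-1}e^{-ax}}{\Gamma(j)}$, $x>0$. For a real-valued function $f$ on $[0,\infty)$, $\|f\|:=\sup_{x\geq 0}|f(x)|$. $[x]$ denotes the largest integer less than or equal to $x$. Let $(S(u),u\ge 0)$ be a gamma process: $S(0)=0$ and, for $u>0$, $S(u)$ has density $x^{u-1}e^{-x}/\Gamma(u)$, $x>0$. For $t>0$ and a function $g$ on $[0,\infty)$ for which the expectations are well defined, set, for $x\ge 0$, $$L_t g(x):=E\,g\Bigl(\frac{S(tx)}{t}\Bigr),\qquad L^{[2]}_t g(x):=2L_{2t}g(x)-L_t g(x),$$ $$M^{[2]}_t g(x):=(tx-[tx])\,L^{[2]}_t g\Bigl(\frac{[tx]+1}{t}\Bigr)+([tx]+1-tx)\,L^{[2]}_t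 g\Bigl(\frac{[tx]}{t}\Bigr).$$ *)

(* Defs.v *)
From HB Require Import structures.
From mathcomp Require Export all_boot all_order all_algebra.
From mathcomp Require Export all_classical all_reals all_analysis.

Set Implicit Arguments.
Unset Strict Implicit.
Unset Printing Implicit Defensive.

Export Order.TTheory GRing.Theory Num.Theory.
Export numFieldNormedType.Exports.

Local Open Scope classical_set_scope.
Local Open Scope ring_scope.

Definition Gamma {R : realType} (u : R) : R :=
  \int[lebesgue_measure]_(x in `]0, +oo[) (x `^ (u - 1) * expR (- x)).

Definition erlang_pdf {R : realType} (a : R) (j : nat) (x : R) : R :=
  if 0 < x then a ^+ j * x ^+ j.-1 * expR (- (a * x)) / Gamma j%:R else 0.

Definition erlang_cdf {R : realType} (a : R) (j : nat) (x : R) : R :=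
  \int[lebesgue_measure]_(y in `]-oo, x]) erlang_pdf a j y.

(* [q] stands for the total mass of the weights [p i j], i < n, 1 <= j; the
   values [p i 0] are never used.  The series is taken in [\bar R] and is a
   convergent series of nonnegative terms when the weights are nonnegative and
   summable, so [fine] then loses nothing.  Only x >= 0 is meaningful. *)
Definition erlang_mixture {R : realType} (n : nat) (a : 'I_n -> R)
    (p : 'I_n -> nat -> R) (q : R) (x : R) : R :=
  (1 - q) + fine (\sum_(i < n) \sum_(1 <= j <oo)
                    (p i j * erlang_cdf (a i) j x)%:E)%E.

Definition gamma_pdf {R : realType} (u x : R) : R :=
  if 0 < x then x `^ (u - 1) * expR (- x) / Gamma u else 0.

(* The one-dimensional laws of a standard gamma process (times u < 0 are
   unconstrained and never used).  The operators below depend on the process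
   only through these laws, so nothing is required of its increments. *)
Definition gamma_process {d : measure_display} {T : measurableType d}
    {R : realType} (P : probability T R) (S : R -> {RV P >-> R}) : Prop :=
  {ae P, forall w, S 0 w = 0} /\
  forall u : R, 0 < u -> forall A : set R, measurable A ->
    distribution P (S u) A
    = (\int[lebesgue_measure]_(x in A) (gamma_pdf u x)%:E)%E.

Section operators.
Context {d : measure_display} {T : measurableType d} {R : realType}.
Context {P : probability T R} (S : R -> {RV P >-> R}).

(* [fine] makes the expectation a real number; the value is meaningful when
   [g (S (t * x) / t)] is integrable. *)
Definition Lop (t : R) (g : R -> R) (x : R) : R :=
  fine 'E_P[fun w : T => g (S (t * x) w / t)%R]%E.

Definition L2op (t : R) (g : R -> R) (x : R) : R :=
  2 * Lop (2 * t) g x - Lop t g x.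

Definition M2op (t : R) (g : R -> R) (x : R) : R :=
  let k : R := (Num.floor (t * x))%:~R in
  (t * x - k) * L2op t g ((k + 1) / t) + (k + 1 - t * x) * L2op t g (k / t).

End operators.

Definition sup_norm {R : realType} (f : R -> R) : \bar R :=
  ereal_sup [set (`|f x|)%:E | x in [set x : R | 0 <= x]].

(* Main.v *)
From HB Require Import structures.
Require Import Defs.
From mathcomp Require Import measurable_realfun ring lra.

Set Implicit Arguments.
Unset Strict Implicit.
Unset Printing Implicit Defensive.

Local Open Scope classical_set_scope.
Local Open Scope ring_scope.

(** The operators are linear, and they reproduce constants, so it suffices to
    treat a single Erlang distribution function, uniformly in its shape; the
    weights [p i j] then average the bounds
    ([norm_wsum_comb_le], [M2op_error]). Scaling by [a] reduces this case to
    scale parameter 1, with mesh [h = a / t] in place of [1 / t].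

    For scale 1 and shape [n.+1] the distribution function is
    [g = 1 - \sum_(i < n.+1) pois i], and its derivatives are iterated
    differences of the Poisson weights [pois n x = x ^+ n / n`! * expR (- x)].
    Everything rests on bounds for these differences that do not depend on [n]:
    [|g''| <= 1], [x |g'''| <= 3/4] and [x ^+ 2 |g''''| <= 49/20]. The [m]-th
    difference equals, up to the factor [x ^- m], the Poisson weight times the
    Charlier polynomial of degree [m], whose square has Poisson mean
    [m`! * x ^+ m] ([charlier_orthogonality]); this bounds the sum over [n] of
    the absolute values of the differences ([sum_norm_dpois_le]). The
    differences themselves sum to 0, so every partial sum is at most half of
    that bound ([norm_subsum_dpois_le]). A value of [g'''] is a single
    second difference, and a value of [g''''] is a partial sum of fourth
    differences.

    At a grid point [x = h k] the operator averages [g] over [h Y], where [Y]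
    has the gamma law with the integer parameter [k], so only the first four
    moments of [Y] matter ([gamma_moment]). Expand [g] at [x] to third order. In
    the combination [2 L_(2t) - L_t] the second order terms cancel, the third
    order terms leave [- h ^+ 2 x g''' / 6], and the remainder is at most a constant
    times [(h Y - x) ^+ 4 / x ^+ 2], down to [Y = 0] ([taylor4_le]). This gives
    the error [29/16 * h ^+ 2] when [2 <= k]; for [k <= 1] the expansion to
    first order and [|g''| <= 1] suffice ([grid_error]). Linear interpolation
    between the grid points adds [h ^+ 2 / 8] ([interpolation_le]), and
    [29/16 + 1/8 = 31/16 <= 17/12 + 27/(16 e)] because [e <= (4/3) ^+ 4]. *)

(** * Iterated differences of the Poisson weights *)

Section poisson.
Context {R : realType}.
Implicit Types (x lam : R) (m n N : nat).

Definition pois n x : R := x ^+ n / n`!%:R * expR (- x).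

(** The [m]-th derivative of [pois n], computed from
    [(pois n.+1)' = pois n - pois n.+1] and [(pois 0)' = - pois 0]; it is also,
    up to sign, the [m]-th backward difference in [n]. *)
Fixpoint dpois m n x : R :=
  match m, n with
  | 0, _ => pois n x
  | m'.+1, 0 => - dpois m' 0 x
  | m'.+1, n'.+1 => dpois m' n' x - dpois m' n'.+1 x
  end.

Lemma dpoisS0 m x : dpois m.+1 0 x = - dpois m 0 x.
Proof. by []. Qed.

Lemma dpoisSS m n x : dpois m.+1 n.+1 x = dpois m n x - dpois m n.+1 x.
Proof. by []. Qed.

Lemma fact_neq0 n : n`!%:R != 0 :> R.
Proof. by rewrite pnatr_eq0 -lt0n fact_gt0. Qed.

Lemma poisS n x : n.+1%:R * pois n.+1 x = x * pois n x.
Proof.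
rewrite /pois factS natrM exprS.
have := fact_neq0 n; have : n.+1%:R != 0 :> R by rewrite pnatr_eq0.
move=> *; field; exact/andP.
Qed.

Lemma pois_ge0 n x : 0 <= x -> 0 <= pois n x.
Proof.
by move=> x0; rewrite !mulr_ge0 ?invr_ge0 ?exprn_ge0 ?expR_ge0 ?ler0n.
Qed.

Lemma pois_le1 n x : 0 <= x -> pois n x <= 1.
Proof.
move=> x0; rewrite /pois expRN ler_pdivrMr ?expR_gt0// mul1r.
case: n => [|k]; first by rewrite expr0 fact0 divr1 -expR0 ler_expR.
by apply: le_trans (expR_ge1Dxn k x0); rewrite lerDr.
Qed.

Lemma is_derive_dpois m n x : is_derive x 1 (dpois m n) (dpois m.+1 n x).
Proof.
elim: m n => [|m IH] [|n].
- rewrite (_ : dpois 0 0 = (fun y => expR (- y))); last first.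
    by apply/funext => y; rewrite /= /pois expr0 fact0 divr1 mul1r.
  apply: is_derive_eq; rewrite /= /pois expr0 fact0 divr1 mul1r /GRing.scale /=.
  by ring.
- rewrite (_ : dpois 0 n.+1 =
      (n.+1`!%:R^-1 : R) *: ((id : R -> R) ^+ n.+1 * (expR \o -%R))); last
    first.
    by apply/funext => y; rewrite /= /pois !fctE /= /GRing.scale /=; ring.
  apply: is_derive_eq; rewrite /= /pois /GRing.scale /= fctE factS natrM exprS.
  have := fact_neq0 n; have : n.+1%:R != 0 :> R by rewrite pnatr_eq0.
  by move=> *; field; exact/andP.
- rewrite (_ : dpois m.+1 0 = (fun y => - dpois m 0 y)) //.
  rewrite dpoisS0.
  have H := IH 0; by apply: is_derive_eq.
- rewrite (_ : dpois m.+1 n.+1 = (fun y => dpois m n y - dpois m n.+1 y)) //.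
  rewrite dpoisSS.
  have H := IH n; have H' := IH n.+1; by apply: is_derive_eq.
Qed.

Lemma sum_dpoisS m n x : \sum_(i < n.+1) dpois m.+1 i x = - dpois m n x.
Proof.
elim: n => [|n IH]; first by rewrite big_ord1 dpoisS0.
by rewrite big_ord_recr /= IH; ring.
Qed.

Lemma cvg_sum_pois x : (\sum_(n < N) pois n x) @[N --> \oo] --> (1 : R).
Proof.
rewrite (_ : (fun N => _) = (fun N => series (exp_coeff x) N * expR (- x))).
  rewrite -(expRxMexpNx_1 x); apply: cvgM; last exact: cvg_cst.
  exact: is_cvg_series_exp_coeff.
by apply/funext => N; rewrite /series /= big_mkord mulr_suml.
Qed.

Lemma cvg_pois0 x : pois n x @[n --> \oo] --> (0 : R).
Proof.
rewrite -[X in _ --> X](mul0r (expR (-x))).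
apply: cvgM; last exact: cvg_cst.
exact: cvg_exp_coeff.
Qed.

Lemma cvg_dpois0 m x : dpois m n x @[n --> \oo] --> (0 : R).
Proof.
elim: m => [|m IH]; first exact: cvg_pois0.
have IHS : (fun n => dpois m n.+1 x) @ \oo --> (0 : R).
  by rewrite (cvg_shiftS (fun n => dpois m n x)).
have := cvgB IH IHS; rewrite subr0 => H.
by rewrite -(cvg_shiftS (fun n => dpois m.+1 n x)); exact: H.
Qed.

(** The monic Charlier polynomial of degree [m], for the Poisson law of
    parameter [x]. *)
Fixpoint charlier m x (r : R) : R :=
  if m is m'.+1 then r * charlier m' x (r - 1) - x * charlier m' x r else 1.

Lemma dpois_charlier m n x :
  x ^+ m * dpois m n x = pois n x * charlier m x n%:R.
Proof.
elim: m n => [|m IH] [|n].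
- by rewrite expr0 mul1r mulr1.
- by rewrite expr0 mul1r mulr1.
- by rewrite dpoisS0 /= mul0r exprS mulrN -mulrA IH; ring.
- rewrite dpoisSS mulrBr exprS -[x * _ * dpois m n x]mulrA.
  rewrite -[x * _ * dpois m n.+1 x]mulrA.
  rewrite !IH /=.
  have E : x * pois n x = (n%:R + 1) * pois n.+1 x by rewrite natr1 poisS.
  rewrite -natr1 addrK [x * (_ * charlier m x n%:R)]mulrA E; ring.
Qed.

Lemma charlierB m x r :
  charlier m x (r + 1) - charlier m x r = m%:R * charlier m.-1 x r.
Proof.
elim: m r => [|m IH] r; first by rewrite /= subrr mul0r.
rewrite /= addrK.
have E1 := IH r; have := IH (r - 1); rewrite subrK => E2.
case: m IH E1 E2 => [|m] IH E1 E2; first by rewrite /=; ring.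
have {}E1 : charlier m.+1 x (r + 1) =
    charlier m.+1 x r + m.+1%:R * charlier m x r.
  by rewrite -E1 [RHS]addrC subrK.
have {}E2 : m.+1%:R * charlier m x (r - 1) =
    charlier m.+1 x r - charlier m.+1 x (r - 1) by rewrite E2.
rewrite E1.
have -> : m.+2%:R = m.+1%:R + 1 :> R by rewrite natr1.
rewrite [in RHS]mulrDl mul1r.
have -> : m.+1%:R * charlier m.+1 x r =
    r * (m.+1%:R * charlier m x (r - 1)) - x * (m.+1%:R * charlier m x r).
  by rewrite /=; ring.
rewrite E2; ring.
Qed.

Definition poisson_mean x (q : R -> R) (v : R) : Prop :=
  (\sum_(n < N) pois n x * q n%:R) @[N --> \oo] --> v.

Lemma poisson_meanD x q1 q2 v1 v2 :
  poisson_mean x q1 v1 -> poisson_mean x q2 v2 ->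
  poisson_mean x (fun r => q1 r + q2 r) (v1 + v2).
Proof.
move=> h1 h2; rewrite /poisson_mean.
under eq_fun do (under eq_bigr do rewrite mulrDr; rewrite big_split /=).
exact: cvgD.
Qed.

Lemma poisson_meanZ x c q v : poisson_mean x q v ->
  poisson_mean x (fun r => c * q r) (c * v).
Proof.
move=> h; rewrite /poisson_mean.
under eq_fun do (under eq_bigr do rewrite mulrCA; rewrite -mulr_sumr).
by apply: cvgM => //; exact: cvg_cst.
Qed.

(** Stein's identity for the Poisson law; it holds term by term, because
    [n.+1 * pois n.+1 x = x * pois n x]. *)
Lemma poisson_mean_shift x q v : poisson_mean x q v ->
  poisson_mean x (fun r => r * q (r - 1)) (x * v).
Proof.
move=> h; pose u N := \sum_(n < N) pois n x * (n%:R * q (n%:R - 1)).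
suff : (fun N => u N.+1) @ \oo --> x * v by rewrite (cvg_shiftS u).
rewrite (_ : (fun N => u N.+1) = fun N => x * \sum_(n < N) pois n x * q n%:R).
  exact: cvgMl_tmp.
apply/funext => N; rewrite /u big_ord_recl /= mul0r mulr0 add0r mulr_sumr.
apply: eq_bigr => i _; rewrite /bump /= add1n mulrA [X in X * _]mulrC poisS.
by rewrite -natr1 addrK mulrA.
Qed.

Lemma poisson_mean_ext x q1 q2 v1 v2 : poisson_mean x q1 v1 ->
  q1 =1 q2 -> v1 = v2 -> poisson_mean x q2 v2.
Proof. by move=> h /funext <- <-. Qed.

(** By Stein's identity, multiplying by the polynomial of degree [k.+1] amounts
    to multiplying by the one of degree [k] and differencing the other factor;
    differencing lowers the degree of a Charlier polynomial by one
    ([charlierB]), so the two means follow from each other by induction. *)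
Lemma charlier_orthogonality x m :
  poisson_mean x (fun r => charlier m x r ^+ 2) (m`!%:R * x ^+ m) /\
  poisson_mean x (fun r => charlier m x r * charlier m.+1 x r) 0.
Proof.
have Cadd1 k r :
    charlier k x (r + 1) = charlier k x r + k%:R * charlier k.-1 x r.
  by rewrite -charlierB; ring.
have step k q v w : poisson_mean x (fun r => charlier k x r * q (r + 1)) v ->
    poisson_mean x (fun r => charlier k x r * q r) w ->
    poisson_mean x (fun r => charlier k.+1 x r * q r) (x * v - x * w).
  move=> hv hw.
  apply: (poisson_mean_ext (poisson_meanD (poisson_mean_shift hv)
    (poisson_meanZ (c := - x) hw))).
    by move=> r /=; rewrite (subrK 1 r); ring.
  by ring.
elim: m => [|m [IH1 IH2]].
  have E1 : poisson_mean x (fun=> 1) 1.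
    rewrite /poisson_mean; under eq_fun do under eq_bigr do rewrite mulr1.
    exact: cvg_sum_pois.
  split.
    apply: (poisson_mean_ext E1) => [r|] /=; rewrite ?expr1n//.
    by rewrite fact0 expr0 mulr1.
  have E1' : poisson_mean x (fun r => charlier 0 x r * 1) 1.
    by apply: (poisson_mean_ext E1) => // r /=; rewrite mulr1.
  apply: (poisson_mean_ext (step 0 (fun=> 1) 1 1 E1' E1')); last first.
    by rewrite subrr.
  by move=> r /=; ring.
have A : poisson_mean x (fun r => charlier m x r * charlier m.+1 x (r + 1))
    (m.+1`!%:R * x ^+ m).
  apply: (poisson_mean_ext (poisson_meanD IH2
    (poisson_meanZ (c := m.+1%:R) IH1))).
    by move=> r; rewrite Cadd1 /=; ring.
  by rewrite factS natrM; ring.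
have B : poisson_mean x (fun r => charlier m.+1 x r ^+ 2)
    (m.+1`!%:R * x ^+ m.+1).
  apply: (poisson_mean_ext (step _ _ _ _ A IH2)) => [r|]; rewrite ?expr2//.
  by rewrite exprS; ring.
split=> //.
have B1 : poisson_mean x (fun r => charlier m.+1 x r * charlier m.+1 x r)
    (m.+1`!%:R * x ^+ m.+1).
  by apply: (poisson_mean_ext B) => // r; rewrite expr2.
have B2 : poisson_mean x
    (fun r => charlier m.+1 x r * charlier m.+1 x (r + 1))
    (m.+1`!%:R * x ^+ m.+1).
  apply: (poisson_mean_ext (poisson_meanD B
    (poisson_meanZ (c := m.+1%:R) IH2))).
    by move=> r; rewrite Cadd1 /=; ring.
  by ring.
apply: (poisson_mean_ext (step _ _ _ _ B2 B1)); last by rewrite subrr.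
by move=> r; rewrite mulrC.
Qed.

Lemma le_poisson_mean x q v N :
  0 <= x -> (forall r, 0 <= q r) -> poisson_mean x q v ->
  \sum_(n < N) pois n x * q n%:R <= v.
Proof.
move=> x0 q0 h.
have nd : nondecreasing_seq (fun N => \sum_(n < N) pois n x * q n%:R).
  apply/nondecreasing_seqP => k; rewrite big_ord_recr /= lerDl.
  by rewrite mulr_ge0 ?pois_ge0.
rewrite -(cvg_lim _ h)//; apply: (nondecreasing_cvgn_le nd).
by apply/cvg_ex; exists v.
Qed.

Lemma sum_pois_le1 N x : 0 <= x -> \sum_(n < N) pois n x <= 1.
Proof.
move=> x0; have [+ _] := charlier_orthogonality x 0.
move=> /(le_poisson_mean N x0 (fun r => sqr_ge0 _)).
by rewrite fact0 mulr1; under eq_bigr do rewrite /= expr1n mulr1.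
Qed.

(** With [u] the quotient of the Charlier polynomial by [x ^+ l], each term is
    [pois n x * |u|], at most [pois n x * (lam * u ^+ 2 + lam^-1) / 2]; the
    means of [u ^+ 2] and of [1] are known. The free [lam] replaces the square
    root of the Cauchy-Schwarz inequality, so the constants are rational. *)
Lemma sum_norm_dpois_le l lam x N : 0 < x -> 0 < lam ->
  x ^+ l * \sum_(n < N) `|dpois l.*2 n x| <= (lam * (l.*2)`!%:R + lam^-1) / 2.
Proof.
move=> x0 l0; have xl := exprn_gt0 l x0.
have H1 := le_poisson_mean N (ltW x0) (fun r => sqr_ge0 _)
  (charlier_orthogonality x l.*2).1.
have H0 := sum_pois_le1 N (ltW x0).
apply: (@le_trans _ _ (\sum_(n < N) (lam / 2 / x ^+ l.*2 *
    (pois n x * charlier l.*2 x n%:R ^+ 2) + lam^-1 / 2 * pois n x))).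
  rewrite mulr_sumr; apply: ler_sum => n _.
  have x2 : x ^+ l.*2 = x ^+ l * x ^+ l by rewrite -addnn exprD.
  have -> : x ^+ l * `|dpois l.*2 n x| =
      pois n x * (`|charlier l.*2 x n%:R| / x ^+ l).
    apply: (mulfI (lt0r_neq0 xl)); rewrite mulrA -x2.
    rewrite -{1}[x ^+ l.*2]ger0_norm ?exprn_ge0 ?(ltW x0)// -normrM.
    rewrite dpois_charlier normrM [`|pois _ _|]ger0_norm ?pois_ge0 ?(ltW x0)//.
    by field; rewrite lt0r_neq0.
  set c := charlier _ _ _.
  have -> : lam / 2 / x ^+ l.*2 * (pois n x * c ^+ 2) + lam^-1 / 2 * pois n x =
    pois n x * (lam / 2 * (`|c| / x ^+ l) ^+ 2 + lam^-1 / 2).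
    have -> : c ^+ 2 = `|c| ^+ 2 by rewrite real_normK ?num_real.
    rewrite x2; field; rewrite !lt0r_neq0//.
  apply: ler_wpM2l; first exact/pois_ge0/ltW.
  set u := `|c| / _.
  have : 0 <= (lam * u - 1) ^+ 2 / (2 * lam).
    by rewrite divr_ge0 ?sqr_ge0 ?mulr_ge0 ?ltW.
  rewrite -subr_ge0; congr (0 <= _); field; rewrite lt0r_neq0//.
rewrite big_split /= -!mulr_sumr mulrDl lerD//.
  apply: le_trans (ler_wpM2l _ H1) _.
    by rewrite !divr_ge0 ?exprn_ge0 ?ltW.
  rewrite le_eqVlt; apply/orP; left; apply/eqP; field.
  by rewrite lt0r_neq0// exprn_gt0.
rewrite -[leRHS]mulr1 ler_wpM2l// divr_ge0 ?invr_ge0 ?ltW//.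
Qed.

(** The differences [dpois l.+1.*2 n x] sum to 0 over all [n], so a partial sum
    and the complementary one have the same absolute value, and each is at most
    half of the sum of the absolute values. For sums up to finite [M] the total
    is [- dpois l.*2.+1 M x], which vanishes in the limit. *)
Lemma norm_subsum_dpois_le l lam x N (A : pred nat) : 0 < x -> 0 < lam ->
  x ^+ l.+1 * `|\sum_(n < N | A n) dpois l.+1.*2 n x|
    <= (lam * (l.+1.*2)`!%:R + lam^-1) / 4.
Proof.
move=> x0 lam0; set B := _ + _.
have key M : (N <= M)%N ->
    x ^+ l.+1 * `|\sum_(n < N | A n) dpois l.+1.*2 n x| <=
    B / 4 + x ^+ l.+1 * `|dpois l.*2.+1 M x| / 2.
  move=> NM.
  pose A' n := A n && (n < N)%N.
  have -> : \sum_(n < N | A n) dpois l.+1.*2 n x =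
      \sum_(n < M.+1 | A' n) dpois l.+1.*2 n x.
    rewrite (big_ord_widen_cond M.+1 A (fun n => dpois l.+1.*2 n x)) //.
    by rewrite (leq_trans NM).
  set s := \sum_(n < _ | _) _.
  have HB := sum_norm_dpois_le l.+1 M.+1 x0 lam0.
  have Hs : \sum_(n < M.+1) dpois l.+1.*2 n x = - dpois l.*2.+1 M x.
    by rewrite doubleS sum_dpoisS.
  rewrite (bigID (fun n : 'I__ => A' n)) /= -/s in Hs.
  rewrite (bigID (fun n : 'I__ => A' n)) /= in HB.
  set s' := \sum_(n < _ | ~~ _) _ in Hs.
  have H1 : `|s| <= \sum_(n < M.+1 | A' n) `|dpois l.+1.*2 n x|.
    exact: ler_norm_sum.
  have H2 : `|s'| <= \sum_(n < M.+1 | ~~ A' n) `|dpois l.+1.*2 n x|.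
    exact: ler_norm_sum.
  have H3 : `|s| <= `|s'| + `|dpois l.*2.+1 M x|.
    have -> : s = - dpois l.*2.+1 M x - s' by rewrite -Hs addrK.
    by rewrite (le_trans (ler_normB _ _))// normrN addrC.
  have xl : 0 < x ^+ l.+1 by exact: exprn_gt0.
  have H4 : x ^+ l.+1 * `|s| + x ^+ l.+1 * `|s'| <= B / 2.
    rewrite -mulrDr; apply: le_trans HB.
    by apply: ler_wpM2l; [exact: ltW|exact: lerD].
  have := ler_wpM2l (ltW xl) H3; rewrite mulrDr.
  move: H4; set a := x ^+ _ * `|s|; set b := x ^+ _ * `|s'|.
  by set c := x ^+ _ * `|_ _ _ _|; lra.
have lim : (B / 4 + x ^+ l.+1 * `|dpois l.*2.+1 M x| / 2) @[M --> \oo] -->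
    B / 4.
  rewrite -[X in _ --> X]addr0; apply: cvgD; first exact: cvg_cst.
  rewrite -[X in _ --> X](mul0r (2^-1)); apply: cvgMr_tmp.
  rewrite -[X in _ --> X](mulr0 (x ^+ l.+1)); apply: cvgMl_tmp.
  rewrite -[X in _ --> X](@normr0 _ R); apply: cvg_norm; exact: cvg_dpois0.
rewrite -(cvg_lim _ lim)//; apply: limr_ge.
  by apply/cvg_ex; exists (B / 4).
by near=> M; apply: key; near: M; exact: nbhs_infty_ge.
Unshelve. all: by end_near. Qed.

Lemma norm_dpois1_le1 n x : 0 <= x -> `|dpois 1 n x| <= 1.
Proof.
move=> x0; have p1 k : 0 <= pois k x <= 1 by rewrite pois_ge0// pois_le1.
case: n => [|n] /=; rewrite ler_norml.
  by have /andP[h1 h2] := p1 0%N; lra.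
by have /andP[h1 h2] := p1 n; have /andP[h3 h4] := p1 n.+1; lra.
Qed.

(** [dpois 2 n x] is a one-term partial sum; the multiplier is [lam = 1]. *)
Lemma norm_dpois2_le n x : 0 < x -> x * `|dpois 2 n x| <= 3 / 4.
Proof.
move=> x0; have := @norm_subsum_dpois_le 0 1 x n.+1 (pred1 n) x0 ltr01.
rewrite expr1 (big_pred1 (@ord_max n)) => [|i].
  move=> H; apply: (le_trans H).
  by rewrite invr1 mul1r (_ : (1.*2)`! = 2)%N//; lra.
by [].
Qed.

(** [- dpois 3 n x] is the sum of the first [n.+1] fourth differences. The
    multiplier [lam = 1 / 5] is close to the inverse square root of [4`!],
    which would be optimal. *)
Lemma norm_dpois3_le n x : 0 < x -> x ^+ 2 * `|dpois 3 n x| <= 49 / 20.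
Proof.
move=> x0; have l0 : 0 < 5^-1 :> R by rewrite invr_gt0.
have := @norm_subsum_dpois_le 1 5^-1 x n.+1 predT x0 l0.
rewrite sum_dpoisS normrN => /le_trans; apply.
by rewrite invrK (_ : (2.*2)`! = 24)%N //; lra.
Qed.

End poisson.

(** * Taylor and interpolation errors *)

Section taylor.
Context {R : realType}.
Implicit Types (x y a b : R).

Lemma norm_increment_le (f df g dg : R -> R) a b : a <= b ->
  (forall x, is_derive x 1 f (df x)) -> (forall x, is_derive x 1 g (dg x)) ->
  (forall x, a < x -> x < b -> `|df x| <= dg x) ->
  `|f b - f a| <= g b - g a.
Proof.
rewrite le_eqVlt => /predU1P[-> _ _ _|ab hf hg hfg].
  by rewrite !subrr normr0.
have nondec (h dh : R -> R) : (forall x, is_derive x 1 h (dh x)) ->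
    (forall x, a < x -> x < b -> 0 <= dh x) -> h a <= h b.
  move=> hh h0; have hc : {within `[a, b], continuous h}.
    apply: derivable_within_continuous => x _.
    by have ? := hh x; exact: ex_derive.
  have [c + {}hc] := MVT ab (fun x _ => hh x) hc.
  rewrite in_itv /= => /andP[ac cb]; rewrite -subr_ge0 hc mulr_ge0 ?h0//.
  by rewrite subr_ge0 ltW.
rewrite ler_norml; apply/andP; split.
- suff : g a + f a <= g b + f b by lra.
  apply: (nondec (fun x => g x + f x) (fun x => dg x + df x)) => x ax xb.
  by have := hfg x ax xb; rewrite ler_norml => /andP[]; lra.
- suff : g a - f a <= g b - f b by lra.
  apply: (nondec (fun x => g x - f x) (fun x => dg x - df x)) => x ax xb.
  by have := hfg x ax xb; rewrite ler_norml => /andP[]; lra.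
Qed.

Variable (g : nat -> R -> R).
Hypothesis dg : forall m x, is_derive x 1 (g m) (g m.+1 x).

(** Taylor polynomials at [x], evaluated at [y], and numbered by the order of
    their remainder. As functions of the base point
    [x] their derivatives consist of a single term, and they equal [g 0 y] at
    [x = y]; the error at [y] is thus an increment in the base point, for which
    [norm_increment_le] suffices. *)
Definition taylor2 x y := g 0 x + g 1 x * (y - x).
Definition taylor4 x y := g 0 x + g 1 x * (y - x) + g 2 x * (y - x) ^+ 2 / 2
  + g 3 x * (y - x) ^+ 3 / 6.

Lemma is_derive_taylor2 y x : is_derive x 1 (taylor2 ^~ y) (g 2 x * (y - x)).
Proof.
rewrite (_ : taylor2 ^~ y = (g 0 + g 1 * (cst y - id))); last first.
  by apply/funext => z; rewrite /taylor2 !fctE.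
have h : is_derive x 1 (cst y - (id : R -> R)) (0 - 1) by exact: is_deriveB.
apply: (is_derive_eq (is_deriveD (dg 0 x) (is_deriveM (dg 1 x) h))).
by rewrite !fctE /GRing.scale /=; ring.
Qed.

Lemma is_derive_taylor4 y x :
  is_derive x 1 (taylor4 ^~ y) (g 4 x * (y - x) ^+ 3 / 6).
Proof.
rewrite (_ : taylor4 ^~ y = (g 0 + g 1 * (cst y - id) +
    (2^-1 : R) *: (g 2 * (cst y - id) ^+ 2) +
    (6^-1 : R) *: (g 3 * (cst y - id) ^+ 3))); last first.
  by apply/funext => z; rewrite /taylor4 !fctE /GRing.scale /=; field.
have h : is_derive x 1 (cst y - (id : R -> R)) (0 - 1) by exact: is_deriveB.
have h1 := is_deriveD (dg 0 x) (is_deriveM (dg 1 x) h).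
have h2 := is_deriveZ (2^-1 : R) (is_deriveM (dg 2 x) (is_deriveX 2 h)).
have h3 := is_deriveZ (6^-1 : R) (is_deriveM (dg 3 x) (is_deriveX 3 h)).
apply: (is_derive_eq (is_deriveD (is_deriveD h1 h2) h3)).
by rewrite !fctE /GRing.scale /= sub0r expr1; field.
Qed.

Lemma taylor2yy y : taylor2 y y = g 0 y.
Proof. by rewrite /taylor2 subrr mulr0 addr0. Qed.
Lemma taylor4yy y : taylor4 y y = g 0 y.
Proof. by rewrite /taylor4 subrr !expr0n /= !mulr0 !mul0r !addr0. Qed.

Lemma is_derive_powB (c y : R) n x :
  is_derive x 1 (fun x => c * (x - y) ^+ n.+1) (c * n.+1%:R * (x - y) ^+ n).
Proof.
rewrite (_ : (fun x => _) = c *: ((id - cst y) ^+ n.+1)); last first.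
  by apply/funext => z; rewrite !fctE.
have h : is_derive x 1 ((id : R -> R) - cst y) (1 - 0) by exact: is_deriveB.
have := is_deriveZ c (is_deriveX n.+1 h).
by rewrite !fctE /GRing.scale /= subr0 mulr1 mulrA; exact.
Qed.

Lemma taylor2_le C x y :
  (forall u, 0 <= u -> `|g 2 u| <= C) -> 0 <= x -> 0 <= y ->
  `|g 0 y - taylor2 x y| <= C / 2 * (y - x) ^+ 2.
Proof.
move=> gC x0 y0; rewrite -taylor2yy.
have [xy|/ltW yx] := leP x y.
- have := norm_increment_le xy (is_derive_taylor2 y)
    (is_derive_powB (- C / 2) y 1).
  rewrite subrr expr0n /= mulr0 => /(_ _)/le_trans; apply; last first.
    by rewrite -sqrrN opprB; lra.
  move=> u xu uy; rewrite normrM expr1.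
  rewrite [`|y - u|]ger0_norm ?subr_ge0 ?(ltW uy)//.
  rewrite [leRHS](_ : _ = C * (y - u)); last by field.
  by rewrite ler_wpM2r ?subr_ge0 ?(ltW uy)// gC// (le_trans x0)// ltW.
- have := norm_increment_le yx (is_derive_taylor2 y)
    (is_derive_powB (C / 2) y 1).
  rewrite subrr expr0n /= mulr0 distrC => /(_ _)/le_trans; apply; last first.
    by rewrite -sqrrN opprB; lra.
  move=> u xu uy; rewrite normrM expr1.
  rewrite [`|y - u|]ler0_norm ?subr_le0 ?(ltW xu)// opprB.
  rewrite [leRHS](_ : _ = C * (u - y)); last by field.
  by rewrite ler_wpM2r ?subr_ge0 ?(ltW xu)// gC// (le_trans y0)// ltW.
Qed.

(** The bound on [g 4] is singular at 0, but the remainder is not: for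
    [y < u < x] one has [(u - y) / u <= (x - y) / x], so that the factor
    [u ^- 2] is absorbed by two of the three factors [u - y] in the derivative
    of the Taylor polynomial with respect to its base point. *)
Lemma taylor4_le C x y :
  (forall u, 0 < u -> u ^+ 2 * `|g 4 u| <= C) -> 0 < x -> 0 <= y ->
  `|g 0 y - taylor4 x y| <= C / (12 * x ^+ 2) * (y - x) ^+ 4.
Proof.
move=> gC x0 y0; rewrite -taylor4yy.
have x2 : 0 < x ^+ 2 by exact: exprn_gt0.
have C0 : 0 <= C by apply: le_trans (gC _ ltr01); rewrite mulr_ge0 ?sqr_ge0.
have [xy|/ltW yx] := leP x y.
- have := norm_increment_le xy (is_derive_taylor4 y)
    (is_derive_powB (- C / (24 * x ^+ 2)) y 3).
  rewrite subrr expr0n /= mulr0 => /(_ _)/le_trans; apply; last first.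
    rewrite sub0r -subr_ge0.
    rewrite (_ : _ - _ = C / (24 * x ^+ 2) * (y - x) ^+ 4); last first.
      by field; rewrite lt0r_neq0.
    apply: mulr_ge0; last by rewrite exprn_even_ge0.
    by rewrite divr_ge0// mulr_ge0// ltW.
  move=> u xu uy; have u0 := lt_trans x0 xu.
  have yu : 0 <= y - u by rewrite subr_ge0 ltW.
  rewrite -mulrA normrM [`|_ / 6|]ger0_norm ?divr_ge0 ?exprn_ge0//.
  rewrite [leRHS](_ : _ = C / x ^+ 2 * ((y - u) ^+ 3 / 6)); last first.
    by field; rewrite lt0r_neq0.
  rewrite ler_wpM2r ?divr_ge0 ?exprn_ge0// ler_pdivlMr// mulrC.
  apply: le_trans (gC u u0); rewrite ler_wpM2r// ler_sqr ?nnegrE ?ltW//.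
- have := norm_increment_le yx (is_derive_taylor4 y)
    (is_derive_powB (C * (x - y) ^+ 2 / (12 * x ^+ 2)) y 1).
  rewrite subrr expr0n /= mulr0 distrC => /(_ _)/le_trans; apply; last first.
    by rewrite le_eqVlt; apply/orP; left; apply/eqP; field; rewrite lt0r_neq0.
  move=> u yu ux; have u0 := le_lt_trans y0 yu.
  have uy : 0 <= u - y by rewrite subr_ge0 ltW.
  have u2 : 0 < u ^+ 2 by exact: exprn_gt0.
  rewrite -mulrA normrM [`|_ / 6|]ler0_norm; last first.
    rewrite -opprB exprNn -signr_odd expr1 mulN1r mulNr oppr_le0.
    by rewrite divr_ge0 ?exprn_ge0.
  rewrite (_ : - (_ / 6) = (u - y) ^+ 3 / 6) ?expr1; last by field.
  have {}gC : `|g 4 u| <= C / u ^+ 2 by rewrite ler_pdivlMr// mulrC gC.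
  apply: (@le_trans _ _ (C / u ^+ 2 * ((u - y) ^+ 3 / 6))).
    by rewrite ler_wpM2r ?divr_ge0 ?exprn_ge0.
  have key : (u - y) / u <= (x - y) / x.
    rewrite ler_pdivrMr// mulrAC ler_pdivlMr// -subr_ge0.
    rewrite [leRHS](_ : _ = y * (x - u)); last by ring.
    by rewrite mulr_ge0// subr_ge0 ltW.
  have key2 : ((u - y) / u) ^+ 2 <= ((x - y) / x) ^+ 2.
    by rewrite ler_sqr// nnegrE divr_ge0 ?subr_ge0// ltW.
  rewrite [leLHS](_ : _ = C * (u - y) / 6 * ((u - y) / u) ^+ 2); last first.
    by field; rewrite lt0r_neq0.
  rewrite [leRHS](_ : _ = C * (u - y) / 6 * ((x - y) / x) ^+ 2); last first.
    by field; rewrite lt0r_neq0.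
  by rewrite ler_wpM2l// divr_ge0// mulr_ge0.
Qed.

Lemma interpolation_le C u h x : (forall u, 0 <= u -> `|g 2 u| <= C) ->
  0 <= u -> 0 < h -> u <= x <= u + h ->
  `|(x - u) / h * g 0 (u + h) + (u + h - x) / h * g 0 u - g 0 x| <=
    C * h ^+ 2 / 8.
Proof.
move=> gC u0 h0 /andP[ux xh]; have x0 : 0 <= x := le_trans u0 ux.
have C0 : 0 <= C := le_trans (normr_ge0 _) (gC 0 (lexx _)).
have H1 := taylor2_le gC x0 (le_trans x0 xh).
have H2 := taylor2_le gC x0 u0.
set r1 := g 0 _ - taylor2 _ _ in H1; set r2 := g 0 _ - taylor2 _ _ in H2.
(* the linear terms of the two expansions at [x] cancel *)
rewrite [X in `|X|](_ : _ = (x - u) / h * r1 + (u + h - x) / h * r2); last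
  first.
  by rewrite /r1 /r2 /taylor2; field; rewrite lt0r_neq0.
have a0 : 0 <= (x - u) / h by rewrite divr_ge0 ?subr_ge0 ?(ltW h0).
have b0 : 0 <= (u + h - x) / h by rewrite divr_ge0 ?subr_ge0 ?(ltW h0).
apply: le_trans (ler_normD _ _) _.
rewrite (normrM ((x - u) / h)) (normrM ((u + h - x) / h)).
rewrite [`|(x - u) / h|]ger0_norm// [`|(u + h - x) / h|]ger0_norm//.
apply: le_trans (lerD (ler_wpM2l a0 H1) (ler_wpM2l b0 H2)) _.
rewrite -subr_ge0 [leRHS](_ : _ = C / 2 * ((x - u) - h / 2) ^+ 2).
  by rewrite mulr_ge0 ?sqr_ge0 ?divr_ge0.
by field; rewrite lt0r_neq0.
Qed.

End taylor.

(** * Integration against a density *)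

Section density.
Local Open Scope ereal_scope.
Context d (T : measurableType d) (R : realType).
Variables (mu nu : {measure set T -> \bar R}) (f : T -> R).
Hypotheses (mf : measurable_fun setT f) (f0 : forall x, (0 <= f x)%R).
Hypothesis nuE : forall A, measurable A -> nu A = \int[mu]_(x in A) (f x)%:E.

Import HBNNSimple.

Lemma ge0_integral_density (h : T -> \bar R) :
  measurable_fun setT h -> (forall x, 0 <= h x) ->
  \int[nu]_x h x = \int[mu]_x (h x * (f x)%:E).
Proof.
move=> mh h0; pose s := nnsfun_approx measurableT mh.
have sh x : (EFin \o s n) x @[n --> \oo] --> h x by exact: cvg_nnsfun_approx.
have nds x : nondecreasing_seq (fun n => (EFin \o s n) x).
  by move=> a b ab; rewrite lee_fin; exact/lefP/nd_nnsfun_approx.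
have mE : measurable_fun setT (EFin \o f) by exact/measurable_EFinP.
have -> : \int[nu]_x h x = limn (fun n => \int[nu]_x (EFin \o s n) x).
  rewrite -monotone_convergence//.
  - by apply: eq_integral => x _; exact/esym/cvg_lim.
  - by move=> n; exact/measurable_EFinP.
  - by move=> n x _; rewrite lee_fin.
have -> : \int[mu]_x (h x * (f x)%:E) =
    limn (fun n => \int[mu]_x ((EFin \o s n) x * (f x)%:E)).
  rewrite -monotone_convergence//.
  - by apply: eq_integral => x _; apply/esym/cvg_lim => //; exact: cvgeZr.
  - by move=> n; apply: emeasurable_funM => //; exact/measurable_EFinP.
  - by move=> n x _; rewrite mule_ge0 ?lee_fin.
  - by move=> x _ a b ab; rewrite lee_wpmul2r ?lee_fin//; exact: nds.
congr (limn _); apply/funext => n; rewrite integralT_nnsfun sintegralE.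
have mind r : measurable_fun setT (fun x => (r * \1_(s n @^-1` [set r]) x)%:E).
  by apply/measurable_EFinP/measurable_funM.
under [RHS]eq_integral => x _.
  rewrite /= fimfunE -fsumEFin// ge0_mule_fsuml; last first.
    by move=> r; exact: nnfun_muleindic_ge0.
  over.
rewrite ge0_integral_fsum//=; last 2 first.
- by move=> r; exact: emeasurable_funM.
- move=> r x _; apply: mule_ge0; rewrite ?lee_fin//.
  exact: nnfun_muleindic_ge0.
apply: eq_fsbigr => r; rewrite inE => -[t _ <-].
under [RHS]eq_integral do rewrite EFinM -muleA.
rewrite ge0_integralZl//; last 3 first.
- by apply: emeasurable_funM => //; exact/measurable_EFinP.
- by move=> x _; rewrite mule_ge0 ?lee_fin.
- by rewrite lee_fin.
congr (_ * _); rewrite nuE// [LHS]integral_mkcond.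
by apply: eq_integral => x _; rewrite muleC epatch_indic.
Qed.

End density.

(** * Erlang distribution functions and gamma moments *)

Section erlang.
Context {R : realType}.
Implicit Types (x a : R) (m n k : nat).
Local Notation mu := (@lebesgue_measure R).

Definition std_erlang n x : R := 1 - \sum_(i < n) pois i x.

(** The [m]-th derivative of [std_erlang n.+1]. *)
Definition derlang n m : R -> R :=
  if m is m'.+1 then dpois m' n else std_erlang n.+1.

Lemma is_derive_derlang n m x : is_derive x 1 (derlang n m) (derlang n m.+1 x).
Proof.
case: m => [|m]; last exact: is_derive_dpois.
rewrite /= /std_erlang.
rewrite (_ : (fun y => _) = cst 1 - (\sum_(i < n.+1) (pois i : R -> R)));
  last first.
  by apply/funext => y; rewrite !fctE fct_sumE.
have H i : is_derive x 1 (pois i) (dpois 1 i x) by exact: (is_derive_dpois 0).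
apply: is_derive_eq.
by rewrite sum_dpoisS sub0r opprK.
Qed.

Lemma continuous_pois n : continuous (@pois R n).
Proof.
move=> x; apply/differentiable_continuous/derivable1_diffP.
by have ? := is_derive_dpois 0 n x; exact: ex_derive.
Qed.

Lemma continuous_std_erlang n : continuous (std_erlang n.+1).
Proof.
move=> x; apply/differentiable_continuous/derivable1_diffP.
by have ? := is_derive_derlang n 0 x; exact: ex_derive.
Qed.

(** [pois n x <= n.+1 / x], because [x * pois n x = n.+1 * pois n.+1 x]. *)
Lemma cvg_pois_pinfty n : pois n x @[x --> +oo] --> (0 : R).
Proof.
apply: (@squeeze_cvgr _ _ _ _ (fun=> 0) (fun x => n.+1%:R * x^-1)).
- near=> x; have x0 : 0 < x by near: x; exact: nbhs_pinfty_gt.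
  rewrite pois_ge0 ?(ltW x0)//= ler_pdivlMr// mulrC -poisS.
  by rewrite ler_piMr// pois_le1// ltW.
- exact: cvg_cst.
- rewrite -[X in _ --> X](mulr0 n.+1%:R); apply: cvgMl_tmp.
  by apply/gtr0_cvgV0; [exact: nbhs_pinfty_gt|exact: cvg_id].
Unshelve. all: by end_near. Qed.

Lemma std_erlang0 n : std_erlang n.+1 0 = 0.
Proof.
rewrite /std_erlang big_ord_recl /= /pois expr0 fact0 oppr0 expR0 divr1 mul1r.
by rewrite big1 ?addr0 ?subrr// => i _; rewrite exprS !mul0r.
Qed.

Lemma std_erlangS n x : std_erlang n.+1 x = std_erlang n x - pois n x.
Proof. by rewrite /std_erlang big_ord_recr /= opprD addrA. Qed.

Lemma cvg_std_erlang n : std_erlang n x @[x --> +oo] --> (1 : R).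
Proof.
elim: n => [|n IH].
  under eq_fun do rewrite /std_erlang big_ord0 subr0.
  exact: cvg_cst.
under eq_fun do rewrite std_erlangS.
have := cvgB IH (@cvg_pois_pinfty n); rewrite subr0; exact.
Qed.

Lemma integral_pois n : (\int[mu]_(x in `]0%R, +oo[) (pois n x)%:E = 1)%E.
Proof.
rewrite integral_itv_obnd_cbnd; last first.
  apply/measurable_EFinP; apply: measurable_funTS.
  by apply: continuous_measurable_fun; exact: continuous_pois.
rewrite (@ge0_continuous_FTC2y _ _ (std_erlang n.+1) 0 1).
- by rewrite std_erlang0 sube0.
- by move=> x x0; exact: pois_ge0.
- by apply: continuous_subspaceT; exact: continuous_pois.
- exact: cvg_std_erlang.
- by move=> x _; have ? := is_derive_derlang n 0 x; exact: ex_derive.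
- by apply: cvg_at_right_filter; exact: continuous_std_erlang.
- move=> x _; have ? := is_derive_derlang n 0 x.
  by rewrite derive1E; exact: derive_val.
Qed.

Lemma GammaS n : Gamma n.+1%:R = n`!%:R :> R.
Proof.
rewrite /Gamma (@eq_Rintegral _ _ _ mu _ (fun x => n`!%:R * pois n x)); last
  first.
  move=> x; rewrite inE /= in_itv /= andbT => x0.
  rewrite -natr1 addrK powR_mulrn ?ltW// /pois.
  by have h : n`!%:R != 0 :> R := fact_neq0 n; field.
rewrite RintegralZl//; last first.
  apply/integrableP; split.
    apply/measurable_EFinP; apply: measurable_funTS.
    by apply: continuous_measurable_fun; exact: continuous_pois.
  under eq_integral => x.
    rewrite inE /= in_itv /= andbT => x0; rewrite ger0_norm ?pois_ge0 ?ltW//.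
    over.
  by rewrite /= integral_pois ltry.
by rewrite /Rintegral integral_pois mulr1.
Qed.

Lemma gamma_pdfE n x : gamma_pdf n.+1%:R x = if 0 < x then pois n x else 0.
Proof.
rewrite /gamma_pdf; case: ifP => // x0.
rewrite GammaS -natr1 addrK powR_mulrn ?ltW//.
by rewrite /pois mulrAC.
Qed.

Lemma erlang_pdfE a n x :
  erlang_pdf a n.+1 x = if 0 < x then a * pois n (a * x) else 0.
Proof.
rewrite /erlang_pdf; case: ifP => // x0; rewrite GammaS /pois /= exprMn exprS.
by have := fact_neq0 n => h; field.
Qed.

Lemma is_derive_scale (f df : R -> R) a x :
  (forall y : R, is_derive y 1 f (df y)) ->
  is_derive x 1 (fun y : R => f (a * y)) (a * df (a * x)).
Proof.
move=> hf; have ? := hf (a * x).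
have h : is_derive x 1 (fun y : R => a * y) a.
  rewrite (_ : (fun y => _) = a *: (id : R -> R)) //.
  by apply: is_derive_eq; rewrite /GRing.scale /= mulr1.
by rewrite mulrC; exact: is_derive1_comp.
Qed.

Lemma erlang_cdfE a n x : 0 < a ->
  erlang_cdf a n.+1 x = std_erlang n.+1 (a * Num.max x 0).
Proof.
move=> a0; rewrite /erlang_cdf.
have [x0|x0] := leP x 0.
  rewrite mulr0 std_erlang0 /Rintegral integral0_eq// => y /=.
  by rewrite in_itv /= => yx; rewrite /erlang_pdf ltNge (le_trans yx x0).
pose f y := a * pois n (a * y); pose F y := std_erlang n.+1 (a * y).
have dF (y : R) : is_derive y 1 F (f y).
  by apply: is_derive_scale => z; exact: (is_derive_derlang n 0).
have cF : continuous F.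
  move=> y; apply/differentiable_continuous/derivable1_diffP.
  by have ? := dF y; exact: ex_derive.
have cf : continuous f.
  move=> y; apply/differentiable_continuous/derivable1_diffP.
  have h := is_derive_scale a y (is_derive_dpois 0 n).
  by have ? := is_deriveZ a h; exact: ex_derive.
rewrite Rintegral_mkcond (_ : _ \_ _ = f \_ `]0, x]); last first.
  apply/funext => y; rewrite !patchE !mem_setE /= !in_itv /= erlang_pdfE.
  by case: (ltP 0 y) => //=; case: ifP.
rewrite -Rintegral_mkcond Rintegral_itv_obnd_cbnd; last first.
  apply: (@integrableS _ _ _ mu `[0, x]) => //; first exact: subset_itv_oc_cc.
  apply: (@continuous_compact_integrable _ _ `[0, x]) => //.
    exact: segment_compact.
  exact: continuous_subspaceT.
rewrite /Rintegral (@continuous_FTC2 _ f F)//.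
- by rewrite -EFinB /= /F mulr0 std_erlang0 subr0.
- exact: continuous_subspaceT.
- split => [y _||].
  + by have ? := dF y; exact: ex_derive.
  + by apply: cvg_at_right_filter; exact: cF.
  + by apply: cvg_at_left_filter; exact: cF.
- by move=> y _; have ? := dF y; rewrite derive1E; exact: derive_val.
Qed.

(** The variable [S k] is nonnegative only almost surely. Its positive part is
    nonnegative everywhere, and an Erlang distribution function, being 0 on the
    negative numbers, takes the same values at both. *)
Definition gammaRV {d} {T : measurableType d} {P : probability T R}
  (S : R -> {RV P >-> R}) (k : nat) (w : T) : R := Num.max (S k%:R w) 0.

Lemma gamma_moment d (T : measurableType d) (P : probability T R)
    (S : R -> {RV P >-> R}) (hS : gamma_process S) k m :
  (\int[P]_w ((gammaRV S k w) ^+ m)%:E = (\prod_(i < m) (k + i)%:R)%:E)%E.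
Proof.
rewrite /gammaRV; case: k => [|k].
  have [S0 _] := hS.
  rewrite (@ae_eq_integral _ _ _ P setT (cst ((0 : R) ^+ m)%:E))//=;
    last 2 first.
  - apply/measurable_EFinP/measurable_funX; exact: measurable_maxr.
  - by apply: filterS S0 => w /= -> _; rewrite maxxx.
  rewrite integral_cst//= probability_setT mule1; congr EFin.
  case: m => [|m]; first by rewrite big_ord0.
  by rewrite big_ord_recl /= addn0 mul0r expr0n.
(* Lebesgue measure lives on [measurableTypeR R], a copy of [R] with the same
   measurable sets, so the law of [S k] is transported there *)
have mX : measurable_fun setT (S k.+1%:R : T -> measurableTypeR R).
  exact: (measurable_funPT (S k.+1%:R)).
pose X : {mfun T >-> measurableTypeR R} :=
  HB.pack (S k.+1%:R : T -> measurableTypeR R)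
    (isMeasurableFun.Build _ _ _ _ _ mX).
pose h (y : measurableTypeR R) := ((Num.max y 0) ^+ m)%:E.
have mh : measurable_fun setT h.
  by apply/measurable_EFinP/measurable_funX; exact: measurable_maxr.
have h0 y : (0 <= h y)%E by rewrite lee_fin exprn_ge0// le_max lexx orbT.
rewrite -(ge0_integral_distribution X mh h0).
have [_ /(_ k.+1%:R)] := hS; rewrite ltr0n => /(_ isT) distE.
have gE (y : R) : gamma_pdf k.+1%:R y = ((@pois R k) \_ `]0, +oo[) y.
  by rewrite gamma_pdfE patchE mem_setE in_itv /= andbT.
have mg : measurable_fun setT (gamma_pdf k.+1%:R : measurableTypeR R -> R).
  rewrite (_ : gamma_pdf _ = (@pois R k) \_ `]0, +oo[); last exact/funext.
  apply/(measurable_restrictT _ _).1 => //; apply: measurable_funTS.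
  by apply: continuous_measurable_fun; exact: continuous_pois.
have g0 (y : measurableTypeR R) : 0 <= gamma_pdf k.+1%:R y :> R.
  rewrite gE patchE mem_setE in_itv /= andbT.
  by case: ifP => // /ltW; exact: pois_ge0.
rewrite (@ge0_integral_density _ _ _ mu _ _ mg g0)//.
pose c : R := \prod_(i < m) (k.+1 + i)%:R.
transitivity (\int[mu]_(x in `]0%R, +oo[) (c%:E * (pois (k + m) x)%:E))%E;
  last first.
  rewrite ge0_integralZl//=.
  - by rewrite integral_pois mule1.
  - apply/measurable_EFinP; apply: measurable_funTS.
    by apply: continuous_measurable_fun; exact: continuous_pois.
  - by move=> x; rewrite /= in_itv /= andbT lee_fin => /ltW; exact: pois_ge0.
  - by rewrite lee_fin prodr_ge0// => i _; rewrite ler0n.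
rewrite [RHS]integral_mkcond; apply: eq_integral => x _.
rewrite gE !patchE mem_setE in_itv /= andbT.
case: ifP => [x0|_]; last by rewrite mule0.
rewrite /h -!EFinM (max_l (ltW x0)); congr EFin.
rewrite /c => {h mh h0 c distE gE mg}.
elim: m => [|m IH]; first by rewrite big_ord0 expr0 addn0.
by rewrite big_ord_recr /= exprS -mulrA IH addnS addSn -mulrA poisS; ring.
Qed.

End erlang.

(** * The error at the grid points *)

Section grid.
Context {R : realType}.

Lemma std_erlang_itv n (x : R) : 0 <= x -> 0 <= std_erlang n x <= 1.
Proof.
move=> x0; rewrite /std_erlang subr_ge0 sum_pois_le1//= gerBl.
by rewrite sumr_ge0// => i _; exact: pois_ge0.
Qed.

Context d (T : measurableType d) (P : probability T R) (S : R -> {RV P >-> R}).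
Hypothesis hS : gamma_process S.
Notation Y := (gammaRV S).

Lemma gammaRV_ge0 k w : 0 <= Y k w.
Proof. by rewrite /gammaRV le_max lexx orbT. Qed.

Lemma measurable_gammaRV k : measurable_fun setT (Y k).
Proof. exact: measurable_maxr. Qed.

Lemma integrable_gammaRVX k m :
  P.-integrable setT (EFin \o (fun w => Y k w ^+ m)).
Proof.
apply/integrableP; split.
  by apply/measurable_EFinP/measurable_funX; exact: measurable_gammaRV.
under eq_integral => w _ do rewrite /= ger0_norm ?exprn_ge0 ?gammaRV_ge0//.
by rewrite gamma_moment// ltry.
Qed.

Lemma expect_gammaX k m : \int[P]_w (Y k w ^+ m) = \prod_(i < m) (k + i)%:R.
Proof. by rewrite /Rintegral gamma_moment. Qed.

Lemma expect_polynomial k n (c : nat -> R) :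
  P.-integrable setT (EFin \o (fun w => \sum_(i < n) c i * Y k w ^+ i)) /\
  \int[P]_w (\sum_(i < n) c i * Y k w ^+ i) =
    \sum_(i < n) c i * \prod_(l < i) (k + l)%:R.
Proof.
elim: n => [|n [IH1 IH2]].
  under eq_fun do rewrite big_ord0; rewrite big_ord0; split.
    rewrite (_ : _ \o _ = cst 0%E) //; exact: integrable0.
  by rewrite Rintegral_cst// mul0r.
have Zi : P.-integrable setT (EFin \o (fun w => c n * Y k w ^+ n)).
  exact: (integrableZl measurableT (c n) (integrable_gammaRVX k n)).
under eq_fun do rewrite big_ord_recr /=; rewrite big_ord_recr /=; split.
  exact: (integrableD measurableT IH1 Zi).
rewrite RintegralD// IH2 RintegralZl//; last exact: integrable_gammaRVX.
by rewrite expect_gammaX.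
Qed.

(** The central moments of orders 2, 3 and 4 of the gamma law with parameter [k]
    are [k], [2 k] and [3 k ^+ 2 + 6 k]. *)
Lemma expect_central k (a0 a1 a2 a3 a4 : R) (f : T -> R) :
  (forall w, f w = a0 + a1 * (Y k w - k%:R) + a2 * (Y k w - k%:R) ^+ 2 +
    a3 * (Y k w - k%:R) ^+ 3 + a4 * (Y k w - k%:R) ^+ 4) ->
  P.-integrable setT (EFin \o f) /\
  \int[P]_w f w =
    a0 + k%:R * a2 + 2 * k%:R * a3 + (3 * k%:R ^+ 2 + 6 * k%:R) * a4.
Proof.
move=> fE; pose r : R := k%:R.
(* coefficients after expansion in powers of the variable itself *)
pose c i := nth 0 [:: a0 - a1 * r + a2 * r ^+ 2 - a3 * r ^+ 3 + a4 * r ^+ 4;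
  a1 - 2 * a2 * r + 3 * a3 * r ^+ 2 - 4 * a4 * r ^+ 3;
  a2 - 3 * a3 * r + 6 * a4 * r ^+ 2; a3 - 4 * a4 * r; a4] i.
have [] := expect_polynomial k 5 c.
have -> : (fun w => \sum_(i < 5) c i * Y k w ^+ i) = f.
  apply/funext => w; rewrite fE !big_ord_recl big_ord0 /= /c /bump /= /r.
  by ring.
move=> -> ->; split => //.
rewrite !big_ord_recl !big_ord0 /= /bump /= !addn0 /c /= /r.
rewrite !add1n !addnS !addn0 -!natr1.
by ring.
Qed.

Lemma expect_approx k (G : T -> R) (a0 a1 a2 a3 b2 b4 : R) :
  P.-integrable setT (EFin \o G) ->
  (forall w, `|G w - (a0 + a1 * (Y k w - k%:R) + a2 * (Y k w - k%:R) ^+ 2 +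
      a3 * (Y k w - k%:R) ^+ 3)| <=
    b2 * (Y k w - k%:R) ^+ 2 + b4 * (Y k w - k%:R) ^+ 4) ->
  `|\int[P]_w G w - (a0 + k%:R * a2 + 2 * k%:R * a3)| <=
    k%:R * b2 + (3 * k%:R ^+ 2 + 6 * k%:R) * b4.
Proof.
move=> iG GE.
pose f w := a0 + a1 * (Y k w - k%:R) + a2 * (Y k w - k%:R) ^+ 2 +
    a3 * (Y k w - k%:R) ^+ 3.
pose e w := b2 * (Y k w - k%:R) ^+ 2 + b4 * (Y k w - k%:R) ^+ 4.
have [i1 E1] : P.-integrable setT (EFin \o f) /\
    \int[P]_w f w = a0 + k%:R * a2 + 2 * k%:R * a3.
  have [w|i ->] := @expect_central k a0 a1 a2 a3 0 f; first by rewrite /f; ring.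
  by split => //; ring.
have [i2 E2] : P.-integrable setT (EFin \o e) /\
    \int[P]_w e w = k%:R * b2 + (3 * k%:R ^+ 2 + 6 * k%:R) * b4.
  have [w|i ->] := @expect_central k 0 0 b2 0 b4 e; first by rewrite /e; ring.
  by split => //; ring.
have iB : P.-integrable setT (EFin \o (fun w => G w - f w)).
  exact: (integrableB measurableT iG i1).
rewrite -E1 -RintegralB//; apply: le_trans (le_normr_Rintegral _ _) _ => //.
rewrite -E2; apply: le_Rintegral => //.
exact: integrable_norm.
Qed.

Variable n : nat.
Notation g := (@derlang R n).

Lemma derlang2_le u : 0 <= u -> `|g 2 u| <= 1.
Proof. exact: norm_dpois1_le1. Qed.

Lemma derlang4_le u : 0 < u -> u ^+ 2 * `|g 4 u| <= 49 / 20.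
Proof. exact: norm_dpois3_le. Qed.

Definition Egamma h k := \int[P]_w (std_erlang n.+1 (h * Y k w)).

Lemma measurable_std_erlang_gammaRV h k :
  measurable_fun setT (fun w => std_erlang n.+1 (h * Y k w)).
Proof.
apply: (measurableT_comp (f := @std_erlang R n.+1)) => //.
  by apply: continuous_measurable_fun; exact: continuous_std_erlang.
by apply: measurable_funM => //; exact: measurable_gammaRV.
Qed.

Lemma integrable_std_erlang_gammaRV h k : 0 <= h ->
  P.-integrable setT (EFin \o (fun w => std_erlang n.+1 (h * Y k w))).
Proof.
move=> h0; apply: (@le_integrable _ _ _ P setT _ _ (EFin \o cst 1)) => //.
- exact/measurable_EFinP/measurable_std_erlang_gammaRV.
- move=> w _.
  have /andP[a b] := std_erlang_itv n.+1 (mulr_ge0 h0 (gammaRV_ge0 k w)).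
  by rewrite lee_fin normr1 ger0_norm.
- by apply: finite_measure_integrable_cst.
Qed.

Lemma Egamma_itv (h : R) k : 0 <= h -> 0 <= Egamma h k <= 1.
Proof.
move=> h0; have I w := std_erlang_itv n.+1 (mulr_ge0 h0 (gammaRV_ge0 k w)).
apply/andP; split; first by apply: Rintegral_ge0 => w _; case/andP: (I w).
rewrite /Egamma (_ : 1 = \int[P]_w (cst 1 w)); last first.
  by rewrite Rintegral_cst// [X in fine X](probability_setT P) mulr1.
apply: le_Rintegral => //; first exact: integrable_std_erlang_gammaRV.
  exact: finite_measure_integrable_cst.
by move=> w _; case/andP: (I w).
Qed.

Lemma Egamma_order2 (h : R) k : 0 <= h ->
  `|Egamma h k - g 0 (h * k%:R)| <= h ^+ 2 * k%:R / 2.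
Proof.
move=> h0; have hk0 : 0 <= h * k%:R by rewrite mulr_ge0.
pose x := h * k%:R.
have := @expect_approx k _ (g 0 x) (h * g 1 x) 0 0 (h ^+ 2 / 2) 0
  (integrable_std_erlang_gammaRV k h0).
rewrite [X in _ - X](_ : _ = g 0 x); last by ring.
rewrite [leRHS](_ : _ = h ^+ 2 * k%:R / 2); last by ring.
apply=> w; have y0 := mulr_ge0 h0 (gammaRV_ge0 k w).
have := taylor2_le (is_derive_derlang n) derlang2_le hk0 y0.
rewrite (_ : taylor2 _ _ _ = g 0 x + h * g 1 x * (Y k w - k%:R) +
   0 * (Y k w - k%:R) ^+ 2 + 0 * (Y k w - k%:R) ^+ 3); last first.
  by rewrite /taylor2 /x; ring.
move/le_trans; apply; rewrite le_eqVlt; apply/orP; left; apply/eqP.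
by rewrite /x; field.
Qed.

Lemma Egamma_order4 (h : R) k : 0 < h -> (0 < k)%N ->
  `|Egamma h k - (g 0 (h * k%:R) + h ^+ 2 * k%:R / 2 * g 2 (h * k%:R)
      + h ^+ 3 * k%:R / 3 * g 3 (h * k%:R))|
   <= 49 / 20 * h ^+ 2 * (1 / 4 + 1 / (2 * k%:R)).
Proof.
move=> h0 k0; have kR : 0 < k%:R :> R by rewrite ltr0n.
pose x := h * k%:R; have x0 : 0 < x by rewrite mulr_gt0.
have := @expect_approx k _ (g 0 x) (h * g 1 x) (h ^+ 2 / 2 * g 2 x)
  (h ^+ 3 / 6 * g 3 x) 0 (49 / 20 * h ^+ 2 / (12 * k%:R ^+ 2))
  (integrable_std_erlang_gammaRV k (ltW h0)).
rewrite [X in `|_ - X|](_ : _ = g 0 x + h ^+ 2 * k%:R / 2 * g 2 x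
  + h ^+ 3 * k%:R / 3 * g 3 x); last by field.
rewrite [leRHS](_ : _ = 49 / 20 * h ^+ 2 * (1 / 4 + 1 / (2 * k%:R)));
  last first.
  by field; rewrite lt0r_neq0.
apply=> w; have y0 := mulr_ge0 (ltW h0) (gammaRV_ge0 k w).
have := taylor4_le (is_derive_derlang n) derlang4_le x0 y0.
rewrite (_ : taylor4 _ _ _ = g 0 x + h * g 1 x * (Y k w - k%:R) +
   (h ^+ 2 / 2 * g 2 x) * (Y k w - k%:R) ^+ 2 +
   (h ^+ 3 / 6 * g 3 x) * (Y k w - k%:R) ^+ 3); last first.
  by rewrite /taylor4 /x; field.
move/le_trans; apply; rewrite le_eqVlt; apply/orP; left; apply/eqP.
by rewrite /x; field; rewrite !lt0r_neq0.
Qed.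

(** The operator [2 L_(2t) - L_t] for [t = 1 / h], applied to [std_erlang n.+1]
    and taken at the grid point [h * k]. *)
Definition extrapolation h k : R :=
  2 * Egamma (h / 2) (k + k) - Egamma h k.

(** The fourth order bound degrades for small [k]: with [C = 49/20] it gives
    [C * (3 / 8 + 5 / (8 k)) + 1 / 8] times [h ^+ 2], which is at most 29/16
    from [k = 2] on. The second order bound gives [k * h ^+ 2], which is enough
    for [k <= 1]. *)
Lemma grid_error (h : R) k : 0 < h ->
  `|extrapolation h k - g 0 (h * k%:R)| <= 29 / 16 * h ^+ 2.
Proof.
rewrite /extrapolation => h0; have h2 : 0 < h / 2 by rewrite divr_gt0.
have xE : h / 2 * (k + k)%:R = h * k%:R by rewrite natrD; field.
have hh : 0 < h ^+ 2 by exact: exprn_gt0.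
have [k1|k2] := leqP k 1.
  have := Egamma_order2 (k + k) (ltW h2); have := Egamma_order2 k (ltW h0).
  rewrite xE natrD; set u := Egamma _ _; set v := Egamma _ _.
  set w := g 0 _ => H1 H2.
  have kR : k%:R <= 1 :> R by rewrite -[1]/(1%:R) ler_nat.
  have kh : h ^+ 2 * k%:R <= h ^+ 2 by rewrite ler_piMr// ltW.
  rewrite (_ : _ - _ - _ = 2 * (v - w) - (u - w)); last by ring.
  apply: le_trans (ler_normB _ _) _; rewrite normrM ger0_norm//.
  rewrite (_ : _ / 2 = h ^+ 2 * k%:R / 4) in H2; last by field.
  by clearbody u v w; lra.
have k0 : (0 < k)%N by exact: leq_trans k2.
have kR : 2 <= k%:R :> R by rewrite ler_nat.
have kp : 0 < k%:R :> R by rewrite ltr0n.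
have := @Egamma_order4 (h / 2) (k + k) h2; rewrite addn_gt0 k0 => /(_ isT).
have := Egamma_order4 h0 k0; rewrite xE natrD.
set x := h * k%:R; set u := Egamma _ _; set v := Egamma _ _.
have x0 : 0 < x by rewrite mulr_gt0.
have := norm_dpois2_le n x0; rewrite -/(g 3 x) => H3.
set r1 := u - _; set r2 := v - _ => H1 H2.
(* the extrapolation cancels the second derivative, not the third *)
rewrite (_ : _ - _ - _ = 2 * r2 - r1 - h ^+ 2 / 6 * (x * g 3 x)); last first.
  by rewrite /r1 /r2 /x; field.
apply: le_trans (ler_normB _ _) _.
have B1 : `|2 * r2 - r1| <= 2 * `|r2| + `|r1|.
  by apply: le_trans (ler_normB _ _) _; rewrite normrM (@ger0_norm _ 2).
have B2 : `|h ^+ 2 / 6 * (x * g 3 x)| = h ^+ 2 / 6 * (x * `|g 3 x|).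
  have h6 : 0 <= h ^+ 2 / 6 by rewrite divr_ge0// ltW.
  by rewrite normrM (ger0_norm h6) normrM (gtr0_norm x0).
rewrite B2.
have B3 : h ^+ 2 / 6 * (x * `|g 3 x|) <= h ^+ 2 / 6 * (3 / 4).
  by rewrite ler_wpM2l// divr_ge0// ltW.
set i := k%:R^-1 : R.
have i2 : i <= 1 / 2 by rewrite /i div1r lef_pV2 ?posrE.
have E1 : 49 / 20 * h ^+ 2 * (1 / 4 + 1 / (2 * k%:R)) =
    49 / 20 * h ^+ 2 * (1 / 4 + i / 2).
  by rewrite /i; field; rewrite lt0r_neq0.
have E2 : 49 / 20 * (h / 2) ^+ 2 * (1 / 4 + 1 / (2 * (k%:R + k%:R))) =
    49 / 80 * h ^+ 2 * (1 / 4 + i / 4).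
  by rewrite /i; field; rewrite !lt0r_neq0 ?addr_gt0.
have hi : h ^+ 2 * i <= h ^+ 2 * (1 / 2) by rewrite ler_wpM2l// ltW.
move: H1 H2 B1 B3 hi; rewrite E1 E2 !mulrDr !mulrA; nra.
Qed.

End grid.

(** * Weighted series *)

Section mix.
Context {R : realType}.
Implicit Types (w v : nat -> R).

Lemma nneseries_from1 (f : nat -> \bar R) :
  (forall j, (1 <= j)%N -> (0 <= f j)%E) ->
  (\sum_(1 <= j <oo) f j = \sum_(j <oo) f j.+1)%E.
Proof.
move=> f0; pose f' j := if j is 0 then 0%E else f j.
have f'0 j : (0 <= f' j)%E by case: j => [|j] //=; exact: f0.
transitivity (\sum_(1 <= j <oo) f' j)%E.
  congr (limn _); apply/funext => N.
  by apply: eq_big_nat => -[|j].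
by rewrite -(nneseries_addn 1)//; apply: eq_eseriesr => j _; rewrite addn1.
Qed.

Definition wsum w v : R := fine (\sum_(j <oo) (w j * v j)%:E).

Section fixed_weights.
Variable w : nat -> R.
Hypothesis w0 : forall j, 0 <= w j.
Hypothesis wfin : (\sum_(j <oo) (w j)%:E)%E \is a fin_num.

Lemma wseries_le v : (forall j, 0 <= v j <= 1) ->
  (\sum_(j <oo) (w j * v j)%:E <= \sum_(j <oo) (w j)%:E)%E.
Proof.
move=> v01; apply: lee_nneseries => j _; have /andP[v0 v1] := v01 j.
  by move=> _; rewrite lee_fin mulr_ge0.
by rewrite lee_fin ler_piMr.
Qed.

Lemma wseries_fin v : (forall j, 0 <= v j <= 1) ->
  (\sum_(j <oo) (w j * v j)%:E)%E \is a fin_num.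
Proof.
move=> v01; rewrite ge0_fin_numE; last first.
  apply: nneseries_ge0 => j _ _; have /andP[v0 _] := v01 j.
  by rewrite lee_fin mulr_ge0.
by apply: le_lt_trans (wseries_le v01) _; rewrite ltey_eq wfin.
Qed.

Lemma cvg_wsum v : (forall j, 0 <= v j <= 1) ->
  \sum_(j < N) w j * v j @[N --> \oo] --> wsum w v.
Proof.
move=> v01; have v0 j : 0 <= v j by case/andP: (v01 j).
have : (\sum_(j < N) (w j * v j)%:E)%E @[N --> \oo] --> (wsum w v)%:E.
  rewrite /wsum fineK ?wseries_fin//.
  under eq_fun do rewrite -(big_mkord predT (fun j => (w j * v j)%:E)).
  by apply: is_cvg_nneseries => j _ _; rewrite lee_fin mulr_ge0.
move/fine_cvg; rewrite /comp /=.
by under eq_fun do rewrite sumEFin.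
Qed.

(** The operator combines four expectations of the mixture and compares them
    with its value: a bound that holds for each component carries over to the
    series, by passing to the limit in the partial sums. *)
Lemma norm_wsum_comb_le (B c1 c2 c3 c4 : R) (v1 v2 v3 v4 v5 : nat -> R) :
  (forall j, 0 <= v1 j <= 1) -> (forall j, 0 <= v2 j <= 1) ->
  (forall j, 0 <= v3 j <= 1) ->
  (forall j, 0 <= v4 j <= 1) -> (forall j, 0 <= v5 j <= 1) ->
  (forall j, `|c1 * v1 j + c2 * v2 j + c3 * v3 j + c4 * v4 j - v5 j| <= B) ->
  `|c1 * wsum w v1 + c2 * wsum w v2 + c3 * wsum w v3 + c4 * wsum w v4
     - wsum w v5| <= B * wsum w (fun=> 1).
Proof.
move=> h1 h2 h3 h4 h5 hB.
have h6 : forall j : nat, 0 <= (1 : R) <= 1 by move=> _; rewrite ler01 lexx.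
pose s v N := \sum_(j < N) w j * v j.
have H : `|c1 * s v1 N + c2 * s v2 N + c3 * s v3 N + c4 * s v4 N - s v5 N|
    @[N --> \oo] --> `|c1 * wsum w v1 + c2 * wsum w v2 + c3 * wsum w v3 +
                      c4 * wsum w v4 - wsum w v5|.
  apply: cvg_norm; apply: cvgB; last exact: cvg_wsum.
  by apply: cvgD; [apply: cvgD; [apply: cvgD|]|]; apply: cvgMl_tmp;
    exact: cvg_wsum.
have H6 : B * s (fun=> 1) N @[N --> \oo] --> B * wsum w (fun=> 1).
  by apply: cvgMl_tmp; exact: cvg_wsum.
apply: (ler_cvg_to H H6); apply: nearW => N.
rewrite /s !mulr_sumr -!big_split -sumrB /=.
apply: le_trans (ler_norm_sum _ _ _) _; apply: ler_sum => j _.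
rewrite mulr1 (_ : _ - _ =
  w j * (c1 * v1 j + c2 * v2 j + c3 * v3 j + c4 * v4 j - v5 j)); last by ring.
by rewrite normrM ger0_norm// mulrC ler_wpM2r.
Qed.

End fixed_weights.
End mix.

(** * Mixtures *)

Section assembly.
Context {R : realType} d (T : measurableType d) (P : probability T R).
Variable S : R -> {RV P >-> R}.
Hypothesis hS : gamma_process S.

Lemma erlang_M_error n (h y : R) k : 0 < h -> h * k%:R <= y <= h * k%:R + h ->
  `|(y - h * k%:R) / h * extrapolation S n h k.+1
    + (h * k%:R + h - y) / h * extrapolation S n h k - std_erlang n.+1 y| <=
    31 / 16 * h ^+ 2.
Proof.
move=> h0 yk; have /andP[y1 y2] := yk.
have u0 : 0 <= h * k%:R by rewrite mulr_ge0 ?(ltW h0).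
have H1 := interpolation_le (is_derive_derlang n) (@derlang2_le R n) u0 h0 yk.
have := grid_error hS n k.+1 h0; have := grid_error hS n k h0.
have -> : h * k.+1%:R = h * k%:R + h by rewrite -natr1; ring.
set a := (y - _) / h in H1 *; set b := (_ - y) / h in H1 *.
set u := extrapolation S n h k; set v := extrapolation S n h k.+1.
rewrite /= in H1 *; set gu := std_erlang _ (h * k%:R) in H1 *.
set gv := std_erlang _ (h * k%:R + h) in H1 *.
set gy := std_erlang _ y in H1 * => H2 H3.
have a0 : 0 <= a by rewrite divr_ge0 ?subr_ge0 ?(ltW h0).
have b0 : 0 <= b by rewrite divr_ge0 ?subr_ge0 ?(ltW h0).
have ab : a + b = 1 by rewrite /a /b; field; rewrite lt0r_neq0.
rewrite (_ : _ - gy = a * (v - gv) + b * (u - gu) + (a * gv + b * gu - gy));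
  last by ring.
apply: le_trans (ler_normD _ _) _.
have : `|a * (v - gv) + b * (u - gu)| <= 29 / 16 * h ^+ 2.
  apply: le_trans (ler_normD _ _) _.
  rewrite (normrM a) (normrM b) (ger0_norm a0) (ger0_norm b0).
  apply: le_trans (lerD (ler_wpM2l a0 H3) (ler_wpM2l b0 H2)) _.
  by rewrite -mulrDl ab mul1r.
by move: H1; lra.
Qed.

Variables (n : nat) (a : 'I_n -> R).
Hypothesis a_gt0 : forall i, 0 < a i.
Variable p : 'I_n -> nat -> R.
Hypothesis p_ge0 : forall (i : 'I_n) (j : nat), (1 <= j)%N -> 0 <= p i j.
Variable q : R.
Hypothesis p_sum : (\sum_(i < n) \sum_(1 <= j <oo) (p i j)%:E)%E = q%:E.
Hypothesis q_le1 : q <= 1.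

Let w i j := p i j.+1.

Let w0 i j : 0 <= w i j. Proof. exact: p_ge0. Qed.

Lemma row_sum i :
  (\sum_(1 <= j <oo) (p i j)%:E)%E = (\sum_(j <oo) (w i j)%:E)%E.
Proof. by rewrite nneseries_from1// => j j1; rewrite lee_fin p_ge0. Qed.

Let row_ge0 i : (0 <= \sum_(j <oo) (w i j)%:E)%E.
Proof. by apply: nneseries_ge0 => j _ _; rewrite lee_fin. Qed.

Lemma row_fin i : (\sum_(j <oo) (w i j)%:E)%E \is a fin_num.
Proof.
rewrite ge0_fin_numE//; apply: le_lt_trans (ltry q); rewrite -p_sum.
under eq_bigr do rewrite row_sum.
by rewrite (bigD1 i)//= leeDl// sume_ge0.
Qed.

Lemma row_sumE i : (\sum_(j <oo) (w i j)%:E)%E = (wsum (w i) (fun=> 1))%:E.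
Proof.
rewrite /wsum fineK; first by apply: eq_eseriesr => j _; rewrite mulr1.
by apply: wseries_fin => //; [exact: row_fin|move=> j; rewrite ler01 lexx].
Qed.

Lemma mixture_seriesE (v : 'I_n -> nat -> R) : (forall i j, 0 <= v i j <= 1) ->
  (\sum_(i < n) \sum_(j <oo) (w i j * v i j)%:E)%E =
    (\sum_(i < n) wsum (w i) (v i))%:E.
Proof.
move=> v01; rewrite -sumEFin; apply: eq_bigr => i _.
by rewrite /wsum fineK// wseries_fin//; exact: row_fin.
Qed.

Lemma erlang_mixtureE y : erlang_mixture a p q y = 1 - q +
  \sum_(i < n) wsum (w i) (fun j => std_erlang j.+1 (a i * Num.max y 0)).
Proof.
rewrite /erlang_mixture; congr (_ + _).
have v01 i j : 0 <= std_erlang j.+1 (a i * Num.max y 0) <= 1.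
  apply: std_erlang_itv.
  by rewrite mulr_ge0 ?(ltW (a_gt0 i))// le_max lexx orbT.
rewrite -[RHS]/(fine (_)%:E) -(mixture_seriesE v01); congr fine.
apply: eq_bigr => i _; rewrite nneseries_from1; last first.
  move=> [//|j] _; rewrite erlang_cdfE// lee_fin mulr_ge0 ?p_ge0//.
  by have /andP[] := v01 i j.
by apply: eq_eseriesr => j _; rewrite erlang_cdfE.
Qed.

(** Expectation and series are exchanged by monotone convergence; division by
    [s] commutes with taking the positive part. *)
Lemma Lop_mixture k (s y : R) (h : 'I_n -> R) : 0 < s -> s * y = k%:R ->
  (forall i, h i = a i / s) -> Lop S s (erlang_mixture a p q) y =
  1 - q + \sum_(i < n) wsum (w i) (fun j => Egamma S j (h i) k).
Proof.
move=> s0 sy /funext ->; rewrite /Lop sy.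
have as0 i : 0 <= a i / s by rewrite divr_ge0 ?ltW.
have v01 x i j : 0 <= std_erlang j.+1 (a i / s * gammaRV S k x) <= 1.
  by apply: std_erlang_itv; rewrite mulr_ge0// gammaRV_ge0.
have E01 i j : 0 <= Egamma S j (a i / s) k <= 1 by exact: Egamma_itv.
pose f i j x := (w i j * std_erlang j.+1 (a i / s * gammaRV S k x))%:E.
have mE i j : measurable_fun setT (f i j).
  apply/measurable_EFinP/measurable_funM => //.
  exact: measurable_std_erlang_gammaRV.
have E0 i j x : (0 <= f i j x)%E.
  by rewrite lee_fin mulr_ge0//; have /andP[] := v01 x i j.
have mS i : measurable_fun setT (fun x => \sum_(j <oo) f i j x)%E.
  by apply: ge0_emeasurable_sum => // j x _ _; exact: E0.
have S0 i x : (0 <= \sum_(j <oo) f i j x)%E.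
  by apply: nneseries_ge0 => j _ _; exact: E0.
rewrite unlock.
rewrite (eq_integral (fun x =>
    ((1 - q)%:E + \sum_(i < n) \sum_(j <oo) f i j x)%E)); last first.
  move=> x _; rewrite erlang_mixtureE EFinD /f (mixture_seriesE (v01 x)).
  congr (_ + (_)%:E)%E; apply: eq_bigr => i _; congr wsum; apply/funext => j.
  congr std_erlang; rewrite /gammaRV -mulrA; congr (_ * _).
  by rewrite -[X in Num.max _ X](mul0r s^-1) [RHS]mulrC maxr_pMl// invr_ge0 ltW.
rewrite ge0_integralD//=; last 3 first.
- by move=> x _; rewrite lee_fin subr_ge0.
- by move=> x _; exact: sume_ge0.
- by apply: emeasurable_sum.
rewrite integral_cst// [X in (_ * X)%E](probability_setT P) mule1.
rewrite ge0_integral_sum// (_ : (\sum_(i < n) _)%E =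
  (\sum_(i < n) wsum (w i) (fun j => Egamma S j (a i / s) k))%:E)//.
rewrite -(mixture_seriesE E01); apply: eq_bigr => i _.
rewrite integral_nneseries//; apply: eq_eseriesr => j _.
have I := integrable_std_erlang_gammaRV S j k (as0 i).
rewrite /Egamma -RintegralZl// /Rintegral fineK//.
by apply: integrable_fin_num => //; exact: (integrableZl measurableT (w i j) I).
Qed.

Variables (t : R) (t_gt0 : 0 < t).

Lemma L2op_mixture k : L2op S t (erlang_mixture a p q) (k%:R / t) =
  1 - q + \sum_(i < n)
    (2 * wsum (w i) (fun j => Egamma S j (a i / t / 2) (k + k))
     - wsum (w i) (fun j => Egamma S j (a i / t) k)).
Proof.
have t2_gt0 : 0 < 2 * t by rewrite mulr_gt0.
have ty : t * (k%:R / t) = k%:R by field; rewrite lt0r_neq0.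
have t2y : 2 * t * (k%:R / t) = (k + k)%:R by rewrite -mulrA ty natrD; ring.
have h2 i : a i / t / 2 = a i / (2 * t) by field; rewrite lt0r_neq0.
have comb (A B : 'I_n -> R) : 2 * (1 - q + \sum_(i < n) A i) -
    (1 - q + \sum_(i < n) B i) = 1 - q + \sum_(i < n) (2 * A i - B i).
  by rewrite sumrB -mulr_sumr; ring.
rewrite /L2op (Lop_mixture t2_gt0 t2y h2).
by rewrite (Lop_mixture t_gt0 ty (fun=> erefl)) comb.
Qed.

Lemma M2op_error x : 0 <= x ->
  `|M2op S t (erlang_mixture a p q) x - erlang_mixture a p q x| <=
    31 / 16 * (\sum_(i < n) wsum (w i) (fun=> 1) * a i ^+ 2) / t ^+ 2.
Proof.
move=> x0; rewrite /M2op.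
have tx0 : 0 <= t * x by rewrite mulr_ge0// ltW.
have [k kE] : exists k : nat, Num.floor (t * x) = k%:Z.
  by exists `|Num.floor (t * x)|%N; rewrite gez0_abs// floor_ge0.
have k1 : k%:R <= t * x by have := floor_le (t * x); rewrite kE.
have k2 : t * x <= k%:R + 1.
  by have := ltW (floorD1_gt (t * x)); rewrite kE intrD.
rewrite kE -[k%:~R]/(k%:R : R).
have -> : k%:R + 1 = k.+1%:R :> R by rewrite natr1.
rewrite !L2op_mixture erlang_mixtureE.
set th := t * x - k%:R.
have E1 : k.+1%:R - t * x = 1 - th by rewrite /th -natr1; ring.
rewrite E1.
(* the constant [1 - q] drops out, as the coefficients add up to 0 *)
have comb (A B C D F : 'I_n -> R) :
    th * (1 - q + \sum_(i < n) (2 * A i - B i)) +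
    (1 - th) * (1 - q + \sum_(i < n) (2 * C i - D i)) -
    (1 - q + \sum_(i < n) F i) =
    \sum_(i < n) (2 * th * A i + (- th) * B i + 2 * (1 - th) * C i
      + (th - 1) * D i - F i).
  by rewrite !sumrB !big_split /= -!mulr_sumr; ring.
rewrite comb {comb}.
apply: le_trans (ler_norm_sum _ _ _) _; rewrite mulr_sumr mulr_suml.
apply: ler_sum => i _.
have h0 : 0 < a i / t by rewrite divr_gt0.
apply: (@le_trans _ _ (31 / 16 * (a i / t) ^+ 2 * wsum (w i) (fun=> 1)));
  last first.
  by rewrite le_eqVlt; apply/orP; left; apply/eqP; field; exact: lt0r_neq0.
apply: norm_wsum_comb_le => //; first exact: row_fin.
- by move=> j; apply: Egamma_itv; rewrite divr_ge0// ltW.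
- by move=> j; apply: Egamma_itv; exact: ltW.
- by move=> j; apply: Egamma_itv; rewrite divr_ge0// ltW.
- by move=> j; apply: Egamma_itv; exact: ltW.
- move=> j; apply: std_erlang_itv.
  by rewrite mulr_ge0 ?(ltW (a_gt0 i))// le_max lexx orbT.
move=> j; rewrite (max_l x0).
have bnd : a i / t * k%:R <= a i * x <= a i / t * k%:R + a i / t.
  apply/andP; split.
    by rewrite mulrAC ler_pdivrMr// -mulrA ler_pM2l// [x * t]mulrC.
  rewrite (_ : _ + _ = a i * (k%:R + 1) / t); last first.
    by field; rewrite lt0r_neq0.
  by rewrite ler_pdivlMr// -mulrA ler_pM2l// [x * t]mulrC.
have := erlang_M_error j h0 bnd; rewrite /extrapolation.
rewrite (_ : (a i * x - a i / t * k%:R) / (a i / t) = th); last first.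
  by rewrite /th; field; rewrite !lt0r_neq0.
rewrite (_ : (a i / t * k%:R + a i / t - a i * x) / (a i / t) = 1 - th);
  last first.
  by rewrite /th; field; rewrite !lt0r_neq0.
have comb (A B C D F : R) : th * (2 * A - B) + (1 - th) * (2 * C - D) - F =
    2 * th * A + - th * B + 2 * (1 - th) * C + (th - 1) * D - F by ring.
by rewrite comb.
Qed.

End assembly.

(** [1 - 1 / 4 <= expR (- (1 / 4))], raised to the fourth power. *)
Lemma expR1_le {R : realType} : expR 1 <= 324 / 100 :> R.
Proof.
have h : 3 / 4 <= expR (- (1 / 4)) :> R.
  by apply: le_trans (expR_ge1Dx _); lra.
have h4 : (3 / 4) ^+ 4 <= (expR (- (1 / 4))) ^+ 4 :> R.
  by rewrite lerXn2r ?nnegrE ?expR_ge0//; lra.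
move: h4; rewrite -expRM_natl (_ : 4%:R * - (1 / 4) = -1); last by field.
rewrite expRN => h4; have e0 : 0 < expR 1 :> R := expR_gt0 1.
have : (3 / 4) ^+ 4 * expR 1 <= 1 :> R by rewrite -ler_pdivlMr// div1r.
by rewrite !exprS expr0; lra.
Qed.

Lemma error_constant_le {R : realType} :
  31 / 16 <= 17 / 12 + 27 / (16 * expR 1) :> R.
Proof.
have e0 : 0 < expR 1 :> R := expR_gt0 1.
have : 25 / 48 <= 27 / (16 * expR 1) :> R.
  by rewrite ler_pdivlMr ?mulr_gt0//; have := @expR1_le R; lra.
by lra.
Qed.

Theorem proposition5p2 (R : realType)
    (d : measure_display) (T : measurableType d) (P : probability T R)
    (S : R -> {RV P >-> R}) (hS : gamma_process S)
    (n : nat) (n_gt0 : (0 < n)%N)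
    (a : 'I_n -> R) (a_gt0 : forall i, 0 < a i)
    (a_incr : forall i j : 'I_n, (i < j)%N -> a i < a j)
    (p : 'I_n -> nat -> R)
    (p_ge0 : forall (i : 'I_n) (j : nat), (1 <= j)%N -> 0 <= p i j)
    (q : R)
    (p_sum : (\sum_(i < n) \sum_(1 <= j <oo) (p i j)%:E)%E = q%:E)
    (q_le1 : q <= 1)
    (t : R) (t_gt0 : 0 < t) :
  let F := erlang_mixture a p q in
  (sup_norm (fun x => (M2op S t F x - F x)%R)
   <= (17 / 12 + 27 / (16 * expR 1))%:E
      * (\sum_(i < n) (\sum_(1 <= j <oo) (p i j)%:E) * (a i ^+ 2)%:E)
      * (t ^- 2)%:E)%E.
Proof.
lazy zeta; rewrite (eq_bigr (fun i =>
    (wsum (fun j => p i j.+1) (fun=> 1) * a i ^+ 2)%:E)); last first.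
  by move=> i _; rewrite (row_sum p_ge0) (row_sumE p_ge0 p_sum) EFinM.
rewrite sumEFin -!EFinM; apply: ge_ereal_sup => _ [x /= x0 <-]; rewrite lee_fin.
apply: le_trans (M2op_error hS a_gt0 p_ge0 p_sum q_le1 t_gt0 x0) _.
rewrite ler_pM2r ?invr_gt0 ?exprn_gt0//.
apply: ler_wpM2r; last exact: error_constant_le.
apply: sumr_ge0 => i _; rewrite mulr_ge0 ?sqr_ge0// /wsum fine_ge0//.
by apply: nneseries_ge0 => j _ _; rewrite mulr1 lee_fin p_ge0.
Qed.
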